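(* Let $\alpha=p/q$ with $p,q$ relatively prime positive integers and $p<q$, and let $\delta>0$ be fixed. Let $(A_{ij})_{i,j\ge0}$ and $(B_{ij})_{i,j\ge0}$ be families of real $N\times N$ matrices, and let $\Xi_{ri}\in\mathbb{R}^N$ be given for all integers $r\ge0$, $i\ge 0$ with $i>r\alpha-1$. Let $X_{rn}\in\mathbb{R}^N$ (for integers $r\ge 0$, $n\ge 0$ with $n>r\alpha-1$) be defined by the recursion $$X_{rn}=\Xi_{rn}+\sum_{r\alpha-1<l\le n-1}\ \sum_{i=0}^{n-l-1}\frac{1}{n-i-r\alpha}A_{i,n-i-l-1}X_{rl}+\chi(r\ge1)\sum_{(r-1)\alpha-1<l\le n-1}\ \sum_{i=0}^{n-l-1}B\big(1-\alpha,\,n-i-(r-1)\alpha\big)B_{i,n-i-l-1}X_{r-1,l}.$$ Define, for $n\ge0$, $$\mathbf{X}_n:=\sum_{r\ge 0:\ r\alpha<n+1}\delta^{-r\alpha}\|X_{rn}\|,\qquad \mathbf{\Xi}_n:=\sum_{r\ge 0:\ r\alpha<n+1}\delta^{-r\alpha}\|\Xi_{rn}\|,$$ and $$L_0:=0,\quad M_0:=0,\quad L_m:=\sum_{i=0}^{m-1}\|A_{i,m-i-1}\|,\quad M_m:=\sum_{i=0}^{m-1}\|B_{i,m-i-1}\|\quad(m\ge1).$$ Suppose that there are constants $R>0$, $C_0$, $C_L$, $C_M$ such that, for all $n\ge0$, $$|\mathbf{\Xi}_n|\le\frac{C_0}{R^n},\qquad |L_n|\le\frac{C_L}{R^n},\qquad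 |M_n|\le\frac{C_M}{R^n}.$$ Then the radius of convergence $R_X$ of the power series $\sum_{n=0}^{\infty}t^n\mathbf{X}_n$ satisfies $$R_X\ge\frac{R}{1+RC_\delta},\qquad\text{where } C_\delta:=q\,C_L+\delta^{-\alpha}B\Big(1-\alpha,\frac1q\Big)C_M .$$
   Context: $\|\cdot\|$ denotes a fixed vector norm on $\mathbb{R}^N$ and also the induced matrix norm on $N\times N$ matrices. $B(\mu,\nu)=\Gamma(\mu)\Gamma(\nu)/\Gamma(\mu+\nu)$ for $\mu,\nu>0$ is the beta function (written with two real arguments), unrelated to the matrices $B_{ij}$ (written with subscripts). $\chi(P)=1$ if the statement $P$ is true and $0$ otherwise; when $r=0$ the last term of the recursion is absent. Summation indices are integers, and sums over empty index sets are $0$. The radius of convergence may be $+\infty$. The recursion arises from substituting $x(t)=\sum_{r\ge 0}\sum_{i>r\alpha-1}t^{i-r\alpha}X_{ri}$, and a similar expansion of $\xi$ with coefficients $\Xi_{ri}$, into the Abel-type Volterra system $x(t)=\xi(t)+\int_0^t\big(a(t,s)+(t-s)^{-\alpha}b(t,s)\big)x(s)\,ds$, where $a(t,s)=\sum_{i,j} t^is^jA_{ij}$ and $b(t,s)=\sum_{i,j} t^is^jB_{ij}$. *)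

(* Defs.v *)
From HB Require Import structures.
From mathcomp Require Import all_boot all_order all_algebra.
From mathcomp Require Import all_classical all_reals all_analysis.

Set Implicit Arguments.
Unset Strict Implicit.
Unset Printing Implicit Defensive.

Import Order.TTheory GRing.Theory Num.Theory.
Import numFieldNormedType.Exports.

Local Open Scope classical_set_scope.
Local Open Scope ring_scope.

(* Nonnegativity and [nrm 0 = 0] follow from the three axioms. *)
Record is_vector_norm (R : realType) (N : nat) (nrm : 'cV[R]_N -> R) : Prop :=
  IsVectorNorm {
    vnormD : forall v w, nrm (v + w) <= nrm v + nrm w ;
    vnormZ : forall (a : R) v, nrm (a *: v) = `|a| * nrm v ;
    vnorm0_eq0 : forall v, nrm v = 0 -> v = 0
  }.

Definition induced_norm (R : realType) (N : nat) (nrm : 'cV[R]_N -> R)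
    (A : 'M[R]_N) : R :=
  sup [set nrm (A *m v) | v in [set v | nrm v <= 1]].

Definition Gamma (R : realType) (x : R) : R :=
  \int[lebesgue_measure]_(t in `]0, +oo[) (t `^ (x - 1) * expR (- t)).

(* The library's [beta_fun] only takes natural number arguments. *)
Definition Beta (R : realType) (x y : R) : R :=
  Gamma x * Gamma y / Gamma (x + y).

(* The fsbigop ranges over a finite set of [r] as soon as [0 < alpha]. *)
Definition weighted_norm_sum (R : realType) (N : nat) (nrm : 'cV[R]_N -> R)
    (alpha delta : R) (Y : nat -> nat -> 'cV[R]_N) (n : nat) : R :=
  \sum_(r \in [set r : nat | r%:R * alpha < n%:R + 1])
     delta `^ (- (r%:R * alpha)) * nrm (Y r n).

(* For [m = 0] the sum is empty. *)
Definition antidiag_norm_sum (R : realType) (N : nat) (nrm : 'cV[R]_N -> R)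
    (A : nat -> nat -> 'M[R]_N) (m : nat) : R :=
  \sum_(0 <= i < m) induced_norm nrm (A i (m - i - 1)%N).

Definition convergence_radius (R : realType) (a : nat -> R) : \bar R :=
  ereal_sup [set r%:E | r in [set r : R | 0 <= r /\ cvgn (pseries a r)]].

(* The coefficients [Y r i] are meaningful only for [r * alpha - 1 < i]; the
   recursion constrains and uses no other ones.  As [r * alpha - 1 >= -1],
   every summation index [l] is automatically nonnegative, and in all ranges
   below the natural number subtractions are exact. *)
Definition satisfies_recursion (R : realType) (N : nat) (alpha : R)
    (A B : nat -> nat -> 'M[R]_N) (Xi X : nat -> nat -> 'cV[R]_N) : Prop :=
  forall r n : nat, r%:R * alpha - 1 < n%:R ->
  X r n =
    Xi r n
    + \sum_(0 <= l < n | r%:R * alpha - 1 < l%:R) \sum_(0 <= i < n - l)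
        (1 / (n%:R - i%:R - r%:R * alpha))
          *: (A i (n - i - l - 1)%N *m X r l)
    + (if (1 <= r)%N then
         \sum_(0 <= l < n | (r%:R - 1) * alpha - 1 < l%:R) \sum_(0 <= i < n - l)
           Beta (1 - alpha) (n%:R - i%:R - (r%:R - 1) * alpha)
             *: (B i (n - i - l - 1)%N *m X r.-1 l)
       else 0).

(* Main.v *)
Require Import Defs.
From mathcomp Require Import all_boot all_order all_algebra.
From mathcomp Require Import all_classical all_reals all_analysis.
From mathcomp Require Import measurable_realfun.
From mathcomp Require Import zify ring lra.
Import Order.TTheory GRing.Theory Num.Theory.
Import numFieldNormedType.Exports.
Local Open Scope ring_scope.

Set Implicit Arguments.
Unset Strict Implicit.
Unset Printing Implicit Defensive.

(* The radius of convergence is in fact at least [rho], which dominates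
   [rho / (1 + rho * Cdelta)]. The one-step estimate of the coefficients by
   [q] and [Beta (1 - alpha) (1 / q)] only yields [rho / (1 + Cdelta)], which
   is too small when [rho < 1]; instead one uses that [1 / e] and
   [Beta (1 - alpha) e] tend to [0] as [e] grows.

   Fix [0 < t < rho] and give the index [(r, n)] the weight
   [w r n = t ^ n * delta ^ (- r * alpha) * |X r n|] and the level
   [q * (n + 1 - r * alpha)], a positive integer. The recursion bounds [w r n] by
   the data plus contributions of indices of strictly lower level, with a
   summable convolution kernel times a coefficient that tends to [0] with the
   level of the contributing index. Hence the sum of [w] over the levels at
   most [k] is bounded for each [k], by induction on [k], while the high
   levels contribute at most half of the total sum, which is therefore
   bounded. *)

(** * Sums graded by a level *)

Lemma ler_sum_nat_widen (R : numDomainType) (a : nat -> R) (m n p : nat) :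
  (forall i, 0 <= a i) -> (n <= p)%N ->
  \sum_(m <= i < n) a i <= \sum_(0 <= i < p) a i.
Proof.
move=> a0 np.
have [nm|mn] := leqP n m; first by rewrite big_geq// sumr_ge0.
rewrite (@big_cat_nat _ _ _ m 0%N p)//= ?(leq_trans (ltnW mn))//.
rewrite (@big_cat_nat _ _ _ n m p)//= ?(ltnW mn)//.
by rewrite addrCA ler_wpDr// addr_ge0 ?sumr_ge0.
Qed.

Lemma exchange_big_triangle (R : nmodType) (F : nat -> nat -> R) (M : nat) :
  \sum_(0 <= n < M) \sum_(0 <= l < n) F n l =
  \sum_(0 <= l < M) \sum_(l.+1 <= n < M) F n l.
Proof.
transitivity (\sum_(0 <= n < M) \sum_(0 <= l < M | (l < n)%N) F n l).
  rewrite big_nat [RHS]big_nat; apply: eq_bigr => n /andP[_ nM].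
  by rewrite (big_nat_widen _ _ _ _ _ (ltnW nM)).
rewrite (exchange_big_dep_nat xpredT)//=; apply: eq_bigr => l _.
by rewrite (big_nat_widenl l.+1 0%N).
Qed.

(** Young's inequality in l^1: after exchanging the sums, each [y l] is multiplied by a partial sum
    of [a] starting at index 1. *)
Lemma ler_sum_convolution (R : numDomainType) (a y : nat -> R) (S : R) (M : nat) :
  (forall i, 0 <= a i) -> (forall i, 0 <= y i) ->
  (forall m, \sum_(0 <= i < m) a i <= S) ->
  \sum_(0 <= n < M) \sum_(0 <= l < n) a (n - l)%N * y l
    <= S * \sum_(0 <= l < M) y l.
Proof.
move=> a0 y0 aS.
rewrite exchange_big_triangle mulr_sumr; apply: ler_sum => l _.
rewrite -mulr_suml ler_wpM2r//.
rewrite -[l.+1]add1n big_addn.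
under eq_bigr do rewrite addnK.
exact: le_trans (ler_sum_nat_widen _ a0 (leqnn _)) (aS _).
Qed.

(** Absorbs the coupling of [r] to [r - 1]: the shift only drops the last term. *)
Lemma ler_sum_shift (R : numDomainType) (G : nat -> R) (P : nat) :
  (forall r, 0 <= G r) ->
  \sum_(0 <= r < P) (if r is r'.+1 then G r' else 0) <= \sum_(0 <= r < P) G r.
Proof.
move=> G0; case: P => [|P]; first by rewrite !big_geq.
by rewrite big_nat_recl//= add0r ler_sum_nat_widen.
Qed.

(** * A recursion feeding each level from strictly lower ones *)

Section level_induction.
Variables (R : realFieldType) (lev : nat -> nat -> nat).
Variables (w xi : nat -> nat -> R) (a b c : nat -> R) (S Xi0 : R).
Hypotheses (w_ge0 : forall r n, 0 <= w r n) (xi_ge0 : forall r n, 0 <= xi r n).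
Hypotheses (a_ge0 : forall m, 0 <= a m) (b_ge0 : forall m, 0 <= b m).
Hypothesis c_ge0 : forall k, 0 <= c k.
Hypothesis sum_a : forall m, \sum_(0 <= i < m) a i <= S.
Hypothesis sum_b : forall m, \sum_(0 <= i < m) b i <= S.
Hypothesis w_lev0 : forall r n, lev r n = 0%N -> w r n = 0.
Hypothesis lev_lt : forall r l n, (l < n)%N -> (0 < lev r l)%N ->
  (lev r l < lev r n)%N /\ (lev r l < lev r.+1 n)%N.
Hypothesis w_rec : forall r n, w r n <= xi r n
  + \sum_(0 <= l < n) a (n - l)%N * (c (lev r l) * w r l)
  + (if r is r'.+1 then
       \sum_(0 <= l < n) b (n - l)%N * (c (lev r' l) * w r' l) else 0).

(** [Q] reweights by level, mainly as the indicator of the low levels or as the constant 1. *)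
Let total (Q : nat -> R) M P :=
  \sum_(0 <= n < M) \sum_(0 <= r < P) Q (lev r n) * w r n.

(** Contributions travel to strictly higher levels, so the weight [Q] at the target is dominated by
    [Q'] at the source. Each of the two kernels has mass at most [S], whence the factor [2 * S]. *)
Lemma level_sum_step (Q Q' : nat -> R) (M P : nat) :
  (forall k, 0 <= Q k <= 1) -> (forall k, 0 <= Q' k) ->
  (forall k k', (k < k')%N -> Q k' <= Q' k) ->
  \sum_(0 <= n < M) \sum_(0 <= r < P) xi r n <= Xi0 ->
  total Q M P <= Xi0 + 2 * S * total (fun k => Q' k * c k) M P.
Proof.
move=> Q01 Q'0 QQ' hXi.
pose y r l := Q' (lev r l) * c (lev r l) * w r l.
have y0 r l : 0 <= y r l by rewrite !mulr_ge0.
have conv_le (d : nat -> R) r s n : (forall m, 0 <= d m) ->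
    (forall l, (l < n)%N -> (0 < lev r l)%N -> (lev r l < lev s n)%N) ->
    Q (lev s n) * (\sum_(0 <= l < n) d (n - l)%N * (c (lev r l) * w r l))
    <= \sum_(0 <= l < n) d (n - l)%N * y r l.
  move=> d0 hlev; rewrite mulr_sumr big_nat [leRHS]big_nat.
  apply: ler_sum => l /andP[_ ln].
  rewrite mulrCA ler_wpM2l// /y -mulrA.
  (* [lev_lt] covers sources of positive level; at level 0 the weight vanishes. *)
  have [l0|] := posnP (lev r l); first by rewrite w_lev0// !mulr0.
  by move=> /(hlev _ ln)/QQ' ?; rewrite ler_wpM2r// mulr_ge0.
have Qw r n : Q (lev r n) * w r n <= xi r n
    + \sum_(0 <= l < n) a (n - l)%N * y r l
    + (if r is r'.+1 then \sum_(0 <= l < n) b (n - l)%N * y r' l else 0).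
  have /andP[Q0 Q1] := Q01 (lev r n).
  apply: le_trans (ler_wpM2l Q0 (w_rec r n)) _.
  rewrite !mulrDr; apply: lerD; first apply: lerD.
  - by rewrite -[leRHS]mul1r ler_wpM2r.
  - by apply: conv_le => // l ln l0; have [] := lev_lt ln l0.
  - case: r {Q0 Q1} => [|r]; first by rewrite mulr0.
    by apply: conv_le => // l ln l0; have [] := lev_lt ln l0.
rewrite /total.
apply: (@le_trans _ _ (\sum_(0 <= n < M) \sum_(0 <= r < P) (xi r n
    + \sum_(0 <= l < n) a (n - l)%N * y r l
    + (if r is r'.+1 then \sum_(0 <= l < n) b (n - l)%N * y r' l else 0)))).
  by apply: ler_sum => n _; apply: ler_sum => r _.
under eq_bigr do rewrite !big_split/=.
rewrite !big_split/= -addrA lerD//.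
rewrite [X in 2 * S * X]exchange_big/= mulrAC mulr_natl mulrC mulr2n mulrDr.
apply: lerD.
  rewrite exchange_big/= mulr_sumr; apply: ler_sum => r _.
  exact: ler_sum_convolution.
apply: (@le_trans _ _ (\sum_(0 <= n < M) \sum_(0 <= r < P)
    \sum_(0 <= l < n) b (n - l)%N * y r l)).
  apply: ler_sum => n _.
  apply: (@ler_sum_shift _ (fun r => \sum_(0 <= l < n) b (n - l)%N * y r l)) => r.
  by rewrite sumr_ge0// => l _; rewrite mulr_ge0.
rewrite exchange_big/= mulr_sumr; apply: ler_sum => r _.
exact: ler_sum_convolution.
Qed.

Variables (K eta : R) (k0 : nat).
Hypothesis eta_ge0 : 0 <= eta.
Hypothesis c_le : forall k, c k <= K.
Hypothesis c_small : forall k, (k0 <= k)%N -> c k <= eta.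
Hypothesis S_eta : 4 * S * eta <= 1.

Let S_ge0 : 0 <= S.
Proof. by apply: le_trans (sum_a 0); rewrite big_geq. Qed.

Let K_ge0 : 0 <= K.
Proof. exact: le_trans (c_ge0 0%N) (c_le 0%N). Qed.

Let total_ge0 Q M P : (forall k, 0 <= Q k) -> 0 <= total Q M P.
Proof.
by move=> Q0; rewrite sumr_ge0// => n _; rewrite sumr_ge0// => r _; rewrite mulr_ge0.
Qed.

Let total_le Q Q' M P : (forall k, (0 < k)%N -> Q k <= Q' k) ->
  total Q M P <= total Q' M P.
Proof.
move=> QQ'; apply: ler_sum => n _; apply: ler_sum => r _.
have [/w_lev0->|l0] := posnP (lev r n); first by rewrite !mulr0.
by rewrite ler_wpM2r// QQ'.
Qed.

Let totalZ x Q M P : total (fun k => x * Q k) M P = x * total Q M P.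
Proof.
rewrite mulr_sumr; apply: eq_bigr => n _; rewrite mulr_sumr.
by apply: eq_bigr => r _; rewrite mulrA.
Qed.

Let totalD Q Q' M P : total (fun k => Q k + Q' k) M P = total Q M P + total Q' M P.
Proof.
rewrite -big_split/=; apply: eq_bigr => n _; rewrite -big_split/=.
by apply: eq_bigr => r _; rewrite mulrDl.
Qed.

(* The sum over the levels at most [k] is bounded by induction on [k], since
   every contribution to a level comes from strictly lower ones. *)
Lemma low_level_sum_bounded (k : nat) : exists D, forall M P,
  \sum_(0 <= n < M) \sum_(0 <= r < P) xi r n <= Xi0 ->
  total (fun j => (j <= k)%N%:R) M P <= D.
Proof.
elim: k => [|k [D hD]].
  exists 0 => M P _; rewrite -(mul0r (total (fun=> 0) M P)) -totalZ.
  by apply: total_le => -[|j]//= _; rewrite mul0r.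
exists (Xi0 + 2 * S * (K * D)) => M P hXi.
(* [Q] selects the levels at most [k + 1]; their sources have level at most [k], where [D] applies,
   and [c] is at most [K]. *)
apply: le_trans (@level_sum_step _ (fun j => (j <= k)%N%:R) M P _ _ _ hXi) _.
- by move=> j; rewrite ler0n lern1 leq_b1.
- by move=> j; rewrite ler0n.
- move=> j j' jj'; rewrite ler_nat; case: (leqP j' k.+1) => // /(leq_trans jj').
  by rewrite ltnS => ->.
rewrite lerD2l ler_wpM2l ?mulr_ge0//.
apply: le_trans (ler_wpM2l K_ge0 (hD _ _ hXi)); rewrite -totalZ.
by apply: total_le => j _; rewrite mulrC ler_wpM2r.
Qed.

(* The levels at least [k0] contribute at most half of the total. *)
Lemma level_sum_bounded : exists D, forall M P,
  \sum_(0 <= n < M) \sum_(0 <= r < P) xi r n <= Xi0 ->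
  \sum_(0 <= n < M) \sum_(0 <= r < P) w r n <= D.
Proof.
have [D hD] := low_level_sum_bounded k0.
(* The finite total [T] will satisfy [T <= Xi0 + 2 * S * (K * D + eta * T)] with
   [2 * S * eta <= 1/2]; absorbing [T / 2] on the left gives the factor 2. *)
exists (2 * (Xi0 + 2 * S * (K * D))) => M P hXi.
have -> : \sum_(0 <= n < M) \sum_(0 <= r < P) w r n = total (fun=> 1) M P.
  by apply: eq_bigr => n _; apply: eq_bigr => r _; rewrite mul1r.
set T := total _ _ _.
have T0 : 0 <= T by apply: total_ge0.
have hT : T <= Xi0 + 2 * S * (K * D + eta * T).
  apply: le_trans (@level_sum_step _ (fun=> 1) M P _ _ _ hXi) _ => //.
    by move=> _; rewrite ler01 lexx.
  rewrite lerD2l ler_wpM2l ?mulr_ge0//.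
  apply: le_trans (lerD (ler_wpM2l K_ge0 (hD _ _ hXi)) (lexx _)).
  rewrite -!totalZ -totalD; apply: total_le => k _; rewrite mul1r mulr1.
  case: leqP => [kk0|k0k]; first by rewrite mulr1 ler_wpDr.
  by rewrite mulr0 add0r c_small// ltnW.
have := ler_wpM2r T0 S_eta; lra.
Qed.

End level_induction.

(** * Decay of the beta function *)

Section gamma_growth.
Variable R : realType.
Local Notation mu := (@lebesgue_measure R).
Local Notation integrand x t := (t `^ (x - 1) * expR (- t)).
Local Notation Igamma x := (\int[mu]_(t in `]0%R, +oo[) (integrand x t)%:E)%E.

Let integrand_ge0 (x t : R) : 0 <= integrand x t.
Proof. by rewrite mulr_ge0 ?powR_ge0 ?expR_ge0. Qed.

Let measurable_integrand (x : R) (D : set R) :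
  @measurable_fun _ _ R (\bar R) D (fun t => (integrand x t)%:E).
Proof.
apply/measurable_EFinP; apply: measurable_funTS; apply: measurable_funM.
  exact: measurable_powR.
exact: measurableT_comp.
Qed.

(** Valid for every real [x]: a divergent integral has real value 0 by convention. *)
Lemma Gamma_ge0 (x : R) : 0 <= Gamma x.
Proof. by apply: Rintegral_ge0 => t _; exact: integrand_ge0. Qed.

Lemma Beta_ge0 (x y : R) : 0 <= Beta x y.
Proof. by rewrite /Beta divr_ge0 ?mulr_ge0 ?Gamma_ge0. Qed.

(* The tail of the integral on the left gains a factor [T `^ - s], while its part on ]0, T]
   is dominated by the contribution of [2T, 3T] to the right-hand side. *)
Lemma Igamma_shift_le (s T eta y : R) : 0 < s -> 1 <= T -> 0 <= eta -> 1 <= y ->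
  2 <= eta * T `^ s -> 2 * expR (3 * T) <= eta * 2 `^ (y - 1) ->
  (Igamma y <= eta%:E * Igamma (s + y))%E.
Proof.
move=> s0 T1 eta0 y1 hT hy.
have T0 : 0 < T by lra.
have Isy0 : (0 <= Igamma (s + y))%E.
  by apply: integral_ge0 => t _; rewrite lee_fin integrand_ge0.
have half_ge0 : 0 <= eta / 2 by lra.
have tail_le (t : R) : T < t -> integrand y t <= eta / 2 * integrand (s + y) t.
  move=> Tt.
  have Ts : T `^ s <= t `^ s by rewrite ge0_ler_powR ?nnegrE; lra.
  have ts : 1 <= eta / 2 * t `^ s by have := ler_wpM2l half_ge0 Ts; lra.
  rewrite mulrA ler_wpM2r ?expR_ge0//.
  rewrite -addrA [t `^ (s + _)]powRD; last by apply/implyP => _; rewrite gt_eqF//; lra.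
  by rewrite mulrA ler_peMl ?powR_ge0.
(* One half of [eta] pays for []0, T]], the other for the tail. *)
have -> : (eta%:E * Igamma (s + y) =
    (eta / 2)%:E * Igamma (s + y) + (eta / 2)%:E * Igamma (s + y))%E.
  rewrite -ge0_muleDl ?lee_fin//; congr (_ * _)%E.
  by rewrite -EFinD; congr EFin; lra.
have -> : (Igamma y = \int[mu]_(t in `]0%R, T]) (integrand y t)%:E +
    \int[mu]_(t in `]T, +oo[) (integrand y t)%:E)%E.
  have -> : (`]0, +oo[%classic : set R) = (`]0, T] `|` `]T, +oo[)%classic.
    by rewrite -itv_bndbnd_setU//= bnd_simp; lra.
  rewrite ge0_integral_setU//=.
  - exact: measurable_integrand.
  - by move=> t _; rewrite lee_fin integrand_ge0.
  - rewrite disj_set2E; apply/eqP/seteqP; split=> // t [/=]; rewrite !in_itv/=; lra.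
apply: leeD.
(* Here the exponential is at most 1 and [y >= 1], so the integral is at most [T * T^(y-1)]. *)
- apply: (@le_trans _ _ (\int[mu]_(t in `]0%R, T]) (T `^ (y - 1))%:E)%E).
    apply: ge0_le_integral; first exact: measurable_itv.
    + by move=> t _; rewrite lee_fin integrand_ge0.
    + exact: measurable_integrand.
    + exact: measurable_cst.
    + move=> t /=; rewrite in_itv/= => /andP[t0 tT]; rewrite lee_fin.
      rewrite -[leRHS]mulr1 ler_pM ?powR_ge0 ?expR_ge0//.
        by rewrite ge0_ler_powR ?nnegrE; lra.
      by rewrite -expR0 ler_expR; lra.
  rewrite integral_cst//= lebesgue_measure_itv/= lte_fin T0 oppr0 adde0.
  (* On [[2T, 3T]], where [t >= 1], the integrand with exponent [s + y] is at least
     [(2T)^(y-1) * exp(-3T)]; the gain [2^(y-1)] beats the loss [exp(-3T)]. *)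
  apply: (@le_trans _ _ ((eta / 2)%:E * \int[mu]_(t in `[(2 * T)%R, (3 * T)%R])
      ((2 * T) `^ (y - 1) * expR (- (3 * T)))%:E)%E).
    rewrite integral_cst//= lebesgue_measure_itv/= lte_fin ifT; last lra.
    rewrite -EFinD -!EFinM lee_fin powRM//; last lra.
    have hy' : 1 <= eta / 2 * (2 `^ (y - 1) * expR (- (3 * T))).
      rewrite expRN mulrA ler_pdivlMr ?expR_gt0//; lra.
    have TT : 0 <= T `^ (y - 1) * T by rewrite mulr_ge0 ?powR_ge0// ltW.
    have := ler_wpM2r TT hy'; lra.
  apply: lee_wpmul2l; first by rewrite lee_fin.
  apply: (@le_trans _ _ (\int[mu]_(t in `[(2 * T)%R, (3 * T)%R]) (integrand (s + y) t)%:E)%E).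
    apply: ge0_le_integral; first exact: measurable_itv.
    + by move=> t _; rewrite lee_fin mulr_ge0 ?powR_ge0 ?expR_ge0.
    + exact: measurable_cst.
    + exact: measurable_integrand.
    + move=> t /=; rewrite in_itv/= => /andP[t0 tT]; rewrite lee_fin.
      rewrite ler_pM ?powR_ge0 ?expR_ge0//; last by rewrite ler_expR; lra.
      apply: (@le_trans _ _ (t `^ (y - 1))).
        by rewrite ge0_ler_powR ?nnegrE; lra.
      by rewrite ler_powR; lra.
  apply: ge0_subset_integral => //=.
  + exact: measurable_integrand.
  + by move=> t _; rewrite lee_fin integrand_ge0.
  + by move=> t/=; rewrite !in_itv/=; lra.
- rewrite -ge0_integralZl//=; last 2 first.
  - exact: measurable_integrand.
  - by move=> t _; rewrite lee_fin integrand_ge0.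
  apply: (@le_trans _ _ (\int[mu]_(t in `]T, +oo[) ((eta / 2)%:E * (integrand (s + y) t)%:E)%E)%E).
    apply: ge0_le_integral; first exact: measurable_itv.
    + by move=> t _; rewrite lee_fin integrand_ge0.
    + exact: measurable_integrand.
    + by apply: measurable_funeM; exact: measurable_integrand.
    + move=> t /=; rewrite in_itv/= andbT => Tt; rewrite -EFinM lee_fin.
      exact: tail_le.
  apply: ge0_subset_integral => //=.
  + by apply: measurable_funeM; exact: measurable_integrand.
  + by move=> t _; rewrite -EFinM lee_fin mulr_ge0 ?integrand_ge0.
  + by move=> t/=; rewrite !in_itv/=; lra.
Qed.

(** [Gamma (s + y) != 0] excludes an infinite integral on the right, whose real value would be 0; a
    finite right side then forces a finite left side. *)
Lemma Gamma_shift_le (s T eta y : R) : 0 < s -> 1 <= T -> 0 <= eta -> 1 <= y ->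
  2 <= eta * T `^ s -> 2 * expR (3 * T) <= eta * 2 `^ (y - 1) ->
  Gamma (s + y) != 0 -> Gamma y <= eta * Gamma (s + y).
Proof.
move=> s0 T1 eta0 y1 hT hy.
have fine_le (I J : \bar R) :
    (I <= eta%:E * J)%E -> (0 <= I)%E -> fine J != 0 -> fine I <= eta * fine J.
  move=> + I0; case: J => [j||]/=; rewrite ?eqxx//.
  by case: I I0 => [i||] //= _; rewrite -EFinM lee_fin.
apply: fine_le; first exact: (Igamma_shift_le s0 T1 eta0 y1 hT hy).
by apply: integral_ge0 => t _; rewrite lee_fin integrand_ge0.
Qed.

(** [Beta s y] is [Gamma s] times [Gamma y / Gamma (s + y)], and this ratio is made at most [eta].
    The constants are chosen in the order [eta], [T], [Y]. *)
Lemma Beta_small (s eps : R) : 0 < s -> 0 < eps ->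
  exists Y, forall y, Y <= y -> Beta s y <= eps.
Proof.
move=> s0 eps0.
have [eta [eta0 heta]] : exists eta, 0 < eta /\ Gamma s * eta <= eps.
  have Gs1 : 0 < Gamma s + 1 by rewrite ltr_wpDl ?Gamma_ge0.
  exists (eps / (Gamma s + 1)); split; first by rewrite divr_gt0.
  by rewrite mulrCA ger_pMr// ler_pdivrMr// mul1r lerDl.
have [T [T1 hT]] : exists T, 1 <= T /\ 2 <= eta * T `^ s.
  exists (1 + (2 / eta) `^ s^-1); split; first by rewrite lerDl powR_ge0.
  rewrite mulrC -ler_pdivrMr//.
  have {1}-> : 2 / eta = ((2 / eta) `^ s^-1) `^ s.
    by rewrite -powRrM mulVf ?gt_eqF// powRr1// divr_ge0// ltW.
  by apply: ge0_ler_powR; rewrite ?nnegrE ?lerDr ?addr_ge0 ?powR_ge0// ltW.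
have [Y [Y1 hY]] : exists Y, 1 <= Y /\
    forall y, Y <= y -> 2 * expR (3 * T) <= eta * 2 `^ (y - 1).
  have ln2 : 0 < ln (2 : R) by rewrite ln_gt0// ltr1n.
  have [E [E0 ->]] : exists E, 0 <= E /\ 2 * expR (3 * T) = eta * E.
    exists (2 * expR (3 * T) / eta); split; last by rewrite mulrCA mulfV ?mulr1// gt_eqF.
    by rewrite divr_ge0 ?mulr_ge0 ?expR_ge0// ltW.
  (* From this threshold on, [2^(y-1) = exp((y-1) * ln 2) >= 1 + (y-1) * ln 2 >= E]. *)
  exists (1 + E / ln 2); split; first by rewrite lerDl divr_ge0// ltW.
  move=> y; rewrite -lerBrDl ler_pdivrMr// => h.
  rewrite ler_wpM2l ?(ltW eta0)// /powR pnatr_eq0/=.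
  apply: le_trans (expR_ge1Dx _).
  by rewrite ler_wpDl.
exists Y => y Yy; rewrite /Beta.
(* Division by 0 gives 0, so a vanishing denominator is harmless. *)
have [->|Gsy] := eqVneq (Gamma (s + y)) 0; first by rewrite invr0 mulr0 ltW.
rewrite ler_pdivrMr; last by rewrite lt_neqAle eq_sym Gsy Gamma_ge0.
have h := Gamma_shift_le s0 T1 (ltW eta0) (le_trans Y1 Yy) hT (hY _ Yy) Gsy.
apply: le_trans (ler_wpM2l (Gamma_ge0 s) h) _.
by rewrite mulrA ler_wpM2r ?Gamma_ge0.
Qed.

End gamma_growth.

(** * Vector norms *)

Section vector_norm.
Local Open Scope classical_set_scope.
Local Open Scope ring_scope.
Variables (R : realType) (N : nat) (nrm : 'cV[R]_N -> R).
Hypothesis hnrm : is_vector_norm nrm.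

Lemma vnorm0 : nrm 0 = 0.
Proof. by rewrite -(scale0r 0) (vnormZ hnrm) normr0 mul0r. Qed.

Lemma vnormN v : nrm (- v) = nrm v.
Proof. by rewrite -scaleN1r (vnormZ hnrm) normrN1 mul1r. Qed.

Lemma vnorm_ge0 v : 0 <= nrm v.
Proof.
have := vnormD hnrm v (- v); rewrite subrr vnorm0 vnormN; lra.
Qed.

Lemma vnorm_sum (I : Type) (r : seq I) (P : pred I) (F : I -> 'cV[R]_N) :
  nrm (\sum_(i <- r | P i) F i) <= \sum_(i <- r | P i) nrm (F i).
Proof.
elim/big_ind2: _ => [|v x w y vx wy|//]; first by rewrite vnorm0.
by apply: le_trans (vnormD hnrm x y) _; exact: lerD.
Qed.

Lemma mx_norm_entry_le (v : 'cV[R]_N) i : `|v i 0| <= `|v^T|.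
Proof.
rewrite [leRHS]/Num.norm/= mx_normrE; apply/bigmax_geP; right => /=.
by exists (0, i) => //=; rewrite mxE.
Qed.

Lemma vnorm_le_mx_norm : exists2 C, 0 <= C & forall v, nrm v <= C * `|v^T|.
Proof.
exists (\sum_i nrm (delta_mx i 0)) => [|v]; first by rewrite sumr_ge0// => i _; exact: vnorm_ge0.
rewrite {1}(matrix_sum_delta v) mulr_suml.
apply: le_trans (vnorm_sum _ _ _) _; apply: ler_sum => i _.
rewrite big_ord1 (vnormZ hnrm) mulrC ler_wpM2l ?vnorm_ge0//.
exact: mx_norm_entry_le.
Qed.

(** Lipschitz for the sup norm, by the reverse triangle inequality. *)
Lemma vnorm_tr_continuous : continuous (fun u : 'rV[R]_N => nrm u^T).
Proof.
have [C C0 hC] := vnorm_le_mx_norm.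
have sub_le (u v : 'cV[R]_N) : nrm u - nrm v <= nrm (u - v).
  by rewrite lerBlDr; apply: le_trans (vnormD hnrm _ _); rewrite subrK.
have lip (u v : 'rV[R]_N) : `|nrm u^T - nrm v^T| <= C * `|u - v|.
  have -> : u - v = (u^T - v^T)^T by rewrite raddfB/= !trmxK.
  apply: le_trans (hC _); rewrite ler_norml sub_le andbT lerNl opprB.
  by rewrite -[leRHS]vnormN opprB.
move=> u; apply/(@cvgrPdist_lt _ _ _ _ (nbhs_filter u)) => e e0.
have C1 : 0 < C + 1 by rewrite ltr_wpDl.
apply: (iffRL (@nbhs_normP R (matrix R 1 N : pseudoMetricNormedZmodType R) u _)).
exists (e / (C + 1)) => [|v /= uv]; first by rewrite /= divr_gt0.
apply: le_lt_trans (lip _ _) _.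
apply: (@le_lt_trans _ _ ((C + 1) * `|u - v|)); first by rewrite ler_wpM2r// lerDl.
by rewrite mulrC -ltr_pdivlMr.
Qed.

(** By compactness [nrm] attains a minimum on the unit sphere of the sup norm; it is positive since
    [nrm] vanishes only at 0, and homogeneity extends the bound. *)
Lemma mx_norm_le_vnorm : exists2 c, 0 < c & forall v, c * `|v^T| <= nrm v.
Proof.
pose A := [set u : 'rV[R]_N | `|u| = 1].
have normalized (v : 'cV[R]_N) : v != 0 -> A (`|v^T|^-1 *: v^T).
  move=> v0; rewrite /A/= normrZ normfV normr_id mulVf//.
  by rewrite normr_eq0 trmx_eq0.
(* If the sphere is empty, every vector is 0 and any positive constant works. *)
have [A0|A0] := pselect (A !=set0); last first.
  exists 1 => // v; have [->|/normalized Av] := eqVneq v 0.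
    by rewrite trmx0 normr0 mulr0 vnorm0.
  by case: A0; exists (`|v^T|^-1 *: v^T).
have cA : compact A.
  apply: bounded_closed_compact.
    exists 1; split=> // x x1 u; rewrite /A/= => ->; exact: ltW.
  have -> : A = Num.norm @^-1` [set (1 : R)] by [].
  apply: closed_comp; last exact: closed_eq.
  by move=> u _; exact: norm_continuous.
have [u uA hu] := compact_EVT_min A0 cA (continuous_subspaceT vnorm_tr_continuous).
have u1 : `|u| = 1 by rewrite inE in uA.
exists (nrm u^T).
  rewrite lt_neqAle vnorm_ge0 andbT eq_sym; apply/eqP => /(vnorm0_eq0 hnrm) /eqP.
  rewrite trmx_eq0 => /eqP u0; move: u1; rewrite u0 normr0 => /eqP.
  by rewrite eq_sym oner_eq0.
move=> v; have [->|v0] := eqVneq v 0; first by rewrite trmx0 normr0 mulr0 vnorm0.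
have vpos : 0 < `|v^T| by rewrite normr_gt0 trmx_eq0.
have := hu _ (mem_set (normalized _ v0)).
rewrite linearZ/= trmxK (vnormZ hnrm) normfV normr_id mulrC.
by rewrite ler_pdivlMr.
Qed.

(** Makes the [sup] in [induced_norm] a genuine least upper bound. Boundedness comes from comparing
    [nrm] with the sup norm in both directions. *)
Lemma induced_norm_has_sup (A : 'M[R]_N) :
  has_sup [set nrm (A *m v) | v in [set v | nrm v <= 1]].
Proof.
split; first by exists (nrm (A *m 0)), 0 => //=; rewrite vnorm0.
have [C C0 hC] := vnorm_le_mx_norm.
have [c c0 hc] := mx_norm_le_vnorm.
exists (C * (\sum_i \sum_j `|A i j|) * c^-1) => _ [v /= v1 <-].
apply: le_trans (hC _) _; rewrite -mulrA ler_wpM2l//.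
have vc : `|v^T| <= c^-1.
  by rewrite -[leRHS]mul1r ler_pdivlMr// mulrC; exact: le_trans (hc _) v1.
apply: (@le_trans _ _ ((\sum_i \sum_j `|A i j|) * `|v^T|)); last first.
  by rewrite ler_wpM2l// sumr_ge0// => i _; rewrite sumr_ge0.
have sA0 i : 0 <= \sum_j `|A i j| by rewrite sumr_ge0.
rewrite [leLHS]/Num.norm/= mx_normrE; apply/bigmax_leP; split.
  by rewrite mulr_ge0// sumr_ge0.
move=> [i j] _ /=; rewrite !mxE.
apply: le_trans (ler_norm_sum _ _ _) _.
apply: (@le_trans _ _ ((\sum_k `|A j k|) * `|v^T|)).
  rewrite mulr_suml; apply: ler_sum => k _; rewrite normrM ler_wpM2l// ord1.
  exact: mx_norm_entry_le.
by rewrite ler_wpM2r// [leRHS](bigD1 j)//= lerDl sumr_ge0.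
Qed.

Lemma induced_norm_ge0 (A : 'M[R]_N) : 0 <= induced_norm nrm A.
Proof.
have [_ ubA] := induced_norm_has_sup A.
by apply: ub_le_sup => //; exists 0; rewrite /= ?vnorm0// mulmx0 vnorm0.
Qed.

Lemma vnorm_mulmx_le (A : 'M[R]_N) v : nrm (A *m v) <= induced_norm nrm A * nrm v.
Proof.
have [->|v0] := eqVneq v 0; first by rewrite mulmx0 vnorm0 mulr0.
have vpos : 0 < nrm v.
  rewrite lt_neqAle vnorm_ge0 andbT eq_sym; apply: contraNneq v0.
  by move/(vnorm0_eq0 hnrm) => ->.
have [_ ubA] := induced_norm_has_sup A.
rewrite -ler_pdivrMr//.
apply: ub_le_sup => //; exists ((nrm v)^-1 *: v) => /=.
  by rewrite (vnormZ hnrm) normfV ger0_norm ?vnorm_ge0// mulVf// gt_eqF.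
by rewrite -scalemxAr (vnormZ hnrm) normfV ger0_norm ?vnorm_ge0// mulrC.
Qed.

End vector_norm.

(** * The recursion *)

Lemma sum_geometric_le (R : realFieldType) (x : R) (m : nat) : 0 <= x -> x < 1 ->
  \sum_(0 <= i < m) x ^+ i <= (1 - x)^-1.
Proof.
move=> x0 x1; have x1' : 0 < 1 - x by rewrite subr_gt0.
rewrite -[leRHS]mul1r ler_pdivlMr// mulrC big_mkord.
have := subrX1 x m; have : 0 <= x ^+ m by rewrite exprn_ge0.
lra.
Qed.

Lemma scaled_sum_le (R : realFieldType) (u : nat -> R) (t rho C : R) (m : nat) :
  0 <= t -> t < rho -> (forall n, `|u n| <= C / rho ^+ n) ->
  \sum_(0 <= i < m) t ^+ i * u i <= C / (1 - t / rho).
Proof.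
move=> t0 trho hu.
have rho0 : 0 < rho by apply: le_lt_trans trho.
have C0 : 0 <= C by have := le_trans (normr_ge0 _) (hu 0%N); rewrite expr0 divr1.
have x0 : 0 <= t / rho by rewrite divr_ge0// ltW.
have x1 : t / rho < 1 by rewrite ltr_pdivrMr// mul1r.
apply: le_trans (ler_wpM2l C0 (sum_geometric_le m x0 x1)).
rewrite mulr_sumr; apply: ler_sum => i _.
apply: (@le_trans _ _ (t ^+ i * (C / rho ^+ i))).
  by rewrite ler_wpM2l ?exprn_ge0//; exact: le_trans (ler_norm _) (hu i).
by rewrite mulrCA expr_div_n.
Qed.

Lemma convergence_radius_ge (R : realType) (a : nat -> R) (t D : R) :
  (forall n, 0 <= a n) -> 0 <= t ->
  (forall M, \sum_(0 <= n < M) t ^+ n * a n <= D) ->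
  (t%:E <= convergence_radius a)%E.
Proof.
move=> a0 t0 hD; apply: ereal_sup_ubound; exists t => //; split=> //.
apply: nondecreasing_is_cvgn.
  apply: nondecreasing_series => n _ _.
  by rewrite mulr_ge0 ?exprn_ge0.
exists D => _ [M _ <-]; apply: le_trans (hD M).
by rewrite /pseries /series/=; apply: ler_sum => i _; rewrite mulrC.
Qed.

(* Every level occurring in the recursion is at least [1], so only finitely
   many values of [Beta] precede the range where it is small. *)
Lemma kernel_coefficient_bound (R : realType) (q : nat) (s eta : R) :
  (0 < q)%N -> 0 < s -> 0 < eta ->
  exists (c : nat -> R) (K : R) (k0 : nat),
    [/\ forall k, 0 <= c k <= K, forall k, (k0 <= k)%N -> c k <= eta &
      forall k k', (0 < k <= k')%N ->
        q%:R / k'%:R <= c k /\ Beta s (k'%:R / q%:R) <= c k].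
Proof.
move=> q0 s0 eta0.
have q0R : 0 < q%:R :> R by rewrite ltr0n.
have [Y hY] := Beta_small s0 eta0.
have [k0 [hk1 hk2]] : exists k0 : nat, q%:R / eta <= k0%:R /\ q%:R * Y <= k0%:R.
  (* Beyond [k0] one has both [q / k <= eta] and [k / q >= Y]. *)
  exists (Num.bound (q%:R / eta) + Num.bound (q%:R * `|Y|))%N; rewrite natrD; split.
    by rewrite ler_wpDr// ltW// archi_boundP// divr_ge0// ltW.
  rewrite ler_wpDl//; apply: (@le_trans _ _ (q%:R * `|Y|)).
    by rewrite ler_wpM2l ?ler_norm.
  by rewrite ltW// archi_boundP// mulr_ge0.
have [K [K0 Kq Kb]] : exists K, [/\ eta <= K, q%:R <= K &
    forall k, (k < k0)%N -> Beta s (k%:R / q%:R) <= K].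
  (* The summands cover the tail, the quotients [q / k] with [k >= 1], and the finitely many [Beta]
     values before [k0]. *)
  exists (eta + q%:R + \sum_(k < k0) Beta s (k%:R / q%:R)).
  have S0 : 0 <= \sum_(k < k0) Beta s (k%:R / q%:R).
    by rewrite sumr_ge0// => k _; exact: Beta_ge0.
  split; [lra|lra|] => k kk0.
  apply: ler_wpDl; first lra.
  rewrite (bigD1 (Ordinal kk0))//= lerDl sumr_ge0// => i _; exact: Beta_ge0.
have small k : (k0 <= k)%N -> q%:R / k%:R <= eta /\ Beta s (k%:R / q%:R) <= eta.
  move=> k0k; have kk : k0%:R <= k%:R :> R by rewrite ler_nat.
  have k_gt0 : 0 < k%:R :> R.
    by apply: lt_le_trans kk; apply: lt_le_trans hk1; rewrite divr_gt0.
  split.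
    rewrite ler_pdivrMr// mulrC -ler_pdivrMr//; exact: le_trans hk1 kk.
  apply: hY; rewrite ler_pdivlMr// mulrC; exact: le_trans hk2 kk.
(* A step function lets [c k] bound the coefficients at every [k' >= k], hence for all values of the
   inner index [i] of the recursion. *)
exists (fun k => if (k0 <= k)%N then eta else K), K, k0; split.
- move=> k; case: ifP => _; first by rewrite ltW.
  by rewrite lexx (le_trans (ltW eta0)).
- by move=> k ->.
- move=> k k' /andP[k_gt0 kk']; case: ifPn => [k0k|_].
    exact: small (leq_trans k0k kk').
  split.
    apply: le_trans Kq; rewrite ler_pdivrMr ?ltr0n ?(leq_trans k_gt0)//.
    by rewrite ler_peMr ?ler0n// ler1n (leq_trans k_gt0).
  have [k0k'|/Kb//] := leqP k0 k'.
  exact: le_trans (small _ k0k').2 K0.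
Qed.

(* For [alpha = p / q], the exponent of [t ^ (n - r * alpha)] in the expansion of [x] is
   [level p q r n / q - 1]; the natural number subtraction truncates to [0]
   exactly when [(r, n)] is not an index of the family. *)
Definition level (p q r n : nat) : nat := (q * n.+1 - r * p)%N.

(** Raising [n] by one adds [q], while raising [r] by one removes only [p < q]. Positivity at the
    source excludes truncation, where both levels could be 0. *)
Lemma level_lt (p q r l n : nat) : (p < q)%N -> (l < n)%N -> (0 < level p q r l)%N ->
  (level p q r l < level p q r n)%N /\ (level p q r l < level p q r.+1 n)%N.
Proof.
rewrite /level => pq ln; have : (q * l.+2 <= q * n.+1)%N by rewrite leq_mul2l ltnS ln orbT.
rewrite (mulnS q l.+1) mulSn; lia.
Qed.

Lemma level_mono (p q r l n : nat) : (l < n)%N -> (level p q r l <= q * n - r * p)%N.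
Proof. by move=> ln; apply: leq_sub2r; rewrite leq_mul2l ln orbT. Qed.

(** * Levels and real exponents *)

Section levels.
Variables (R : realType) (p q : nat) (alpha : R).
Hypotheses (q_gt0 : (0 < q)%N) (alphaE : alpha = p%:R / q%:R).

Lemma exponent_level (r m : nat) : (r * p <= q * m)%N ->
  m%:R - r%:R * alpha = (q * m - r * p)%:R / q%:R.
Proof.
move=> rpqm; rewrite natrB// !natrM alphaE; field.
by rewrite pnatr_eq0 -lt0n.
Qed.

Lemma level_gt0 (r n : nat) : (r%:R * alpha < n%:R + 1) = (0 < level p q r n)%N.
Proof.
have q0 : 0 < q%:R :> R by rewrite ltr0n.
rewrite alphaE mulrA ltr_pdivrMr// natr1 -!natrM ltr_nat subn_gt0.
by rewrite mulnC [(_ * q)%N]mulnC [(p * _)%N]mulnC.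
Qed.

(** Since [p >= 1], a positive level forces [r < q * (n + 1)], so one finite range holds every
    relevant [r]. *)
Lemma weighted_norm_sumE (N : nat) (nrm : 'cV[R]_N -> R) (delta : R)
    (Y : nat -> nat -> 'cV[R]_N) (n P : nat) : (0 < p)%N -> (q * n.+1 <= P)%N ->
  weighted_norm_sum nrm alpha delta Y n =
  \sum_(0 <= r < P | (0 < level p q r n)%N) delta `^ (- (r%:R * alpha)) * nrm (Y r n).
Proof.
move=> p0 qP; rewrite [RHS]bigfs ?iota_uniq//; last first.
  move=> r; rewrite /level subn_gt0 mem_index_iota/= -leqNgt => rp Pr.
  by have := leq_trans qP Pr; rewrite leqNgt (leq_ltn_trans _ rp)// leq_pmulr.
by apply: eq_fsbigl; apply/seteqP; split => r /=; rewrite level_gt0.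
Qed.

End levels.

(** * The recursion for the weighted norms *)

Section weighted_recursion.
Variables (R : realType) (N : nat) (nrm : 'cV[R]_N -> R).
Hypothesis hnrm : is_vector_norm nrm.

Lemma antidiag_norm_sum_ge0 (A : nat -> nat -> 'M[R]_N) m :
  0 <= antidiag_norm_sum nrm A m.
Proof. by rewrite sumr_ge0// => i _; exact: induced_norm_ge0. Qed.

Lemma vnorm_antidiag_le (A : nat -> nat -> 'M[R]_N) (l n : nat) (g : nat -> R) (c : R) v :
  (forall i, (i < n - l)%N -> `|g i| <= c) ->
  nrm (\sum_(0 <= i < n - l) g i *: (A i (n - i - l - 1)%N *m v))
    <= antidiag_norm_sum nrm A (n - l) * (c * nrm v).
Proof.
move=> hg; apply: le_trans (vnorm_sum hnrm _ _ _) _.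
rewrite /antidiag_norm_sum mulr_suml big_nat [leRHS]big_nat.
apply: ler_sum => i /andP[_ il]; rewrite (vnormZ hnrm) [leRHS]mulrCA.
rewrite [(n - l - i)%N]subnAC.
by apply: ler_pM; rewrite ?vnorm_ge0 ?hg ?vnorm_mulmx_le.
Qed.

Variables (p q : nat) (alpha delta t : R).
Hypotheses (pq : (p < q)%N) (alphaE : alpha = p%:R / q%:R).
Hypotheses (delta_gt0 : 0 < delta) (t_gt0 : 0 < t).

(** The value 0 off the index family lets later sums run over full rectangles of pairs [(r, n)]. *)
Definition weighted_norm (Y : nat -> nat -> 'cV[R]_N) (r n : nat) : R :=
  if (0 < level p q r n)%N then t ^+ n * (delta `^ (- (r%:R * alpha)) * nrm (Y r n))
  else 0.

Lemma weighted_norm_ge0 Y r n : 0 <= weighted_norm Y r n.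
Proof.
rewrite /weighted_norm; case: ifP => // _.
by rewrite !mulr_ge0 ?exprn_ge0 ?powR_ge0 ?vnorm_ge0// ltW.
Qed.

Let q_gt0 : (0 < q)%N. Proof. exact: leq_trans pq. Qed.

Variables (A B : nat -> nat -> 'M[R]_N) (Xi X : nat -> nat -> 'cV[R]_N).
Hypothesis hrec : satisfies_recursion alpha A B Xi X.
Variable c : nat -> R.
Hypothesis c_bound : forall k k', (0 < k <= k')%N ->
  q%:R / k'%:R <= c k /\ Beta (1 - alpha) (k'%:R / q%:R) <= c k.

(** [t ^ n] splits into [t ^ (n - l)], absorbed by the kernel, and [t ^ l], kept with the weight at
    [l]. *)
Lemma weighted_term_le (D : nat -> nat -> 'M[R]_N) (g : nat -> R) (r l n : nat) :
  (l < n)%N -> (0 < level p q r l)%N ->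
  (forall i, (i < n - l)%N -> `|g i| <= c (level p q r l)) ->
  t ^+ n * (delta `^ (- (r%:R * alpha)) *
    nrm (\sum_(0 <= i < n - l) g i *: (D i (n - i - l - 1)%N *m X r l)))
  <= t ^+ (n - l) * antidiag_norm_sum nrm D (n - l) *
    (c (level p q r l) * weighted_norm X r l).
Proof.
move=> ln lev hg; rewrite /weighted_norm lev.
rewrite -{1}(subnK (ltnW ln)) exprD.
set d := delta `^ _; set L := antidiag_norm_sum _ _ _; set k := c _.
have -> : t ^+ (n - l) * L * (k * (t ^+ l * (d * nrm (X r l)))) =
    t ^+ (n - l) * t ^+ l * (d * (L * (k * nrm (X r l)))) by ring.
rewrite ler_wpM2l ?mulr_ge0 ?exprn_ge0 ?(ltW t_gt0)// ler_wpM2l ?powR_ge0//.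
exact: vnorm_antidiag_le.
Qed.

Lemma weighted_norm_recursion (r n : nat) :
  weighted_norm X r n <= weighted_norm Xi r n
  + \sum_(0 <= l < n) t ^+ (n - l) * antidiag_norm_sum nrm A (n - l) *
      (c (level p q r l) * weighted_norm X r l)
  + (if r is r'.+1 then
       \sum_(0 <= l < n)
         delta `^ (- alpha) * (t ^+ (n - l) * antidiag_norm_sum nrm B (n - l)) *
         (c (level p q r' l) * weighted_norm X r' l)
     else 0).
Proof.
have c_ge0 k : (0 < k)%N -> 0 <= c k.
  move=> k0; have [+ _] := @c_bound k k (introT andP (conj k0 (leqnn k))).
  by apply: le_trans; rewrite divr_ge0.
have term_ge0 s l (D : nat -> nat -> 'M[R]_N) :
    0 <= t ^+ (n - l) * antidiag_norm_sum nrm D (n - l) *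
      (c (level p q s l) * weighted_norm X s l).
  have [l0|l0] := posnP (level p q s l); first by rewrite /weighted_norm l0 !mulr0.
  by rewrite !mulr_ge0 ?weighted_norm_ge0 ?antidiag_norm_sum_ge0 ?exprn_ge0 ?c_ge0// ltW.
have valid s l : (s%:R * alpha - 1 < l%:R) = (0 < level p q s l)%N.
  by rewrite ltrBlDr (level_gt0 q_gt0 alphaE).
(* Serves both sums of the recursion: [s] is [r] in the first and [r - 1] in the second. *)
have sum_le s (D : nat -> nat -> 'M[R]_N) (g : nat -> nat -> R) :
    (forall l i, (l < n)%N -> (0 < level p q s l)%N -> (i < n - l)%N ->
       `|g l i| <= c (level p q s l)) ->
    t ^+ n * (delta `^ (- (s%:R * alpha)) *
      nrm (\sum_(0 <= l < n | s%:R * alpha - 1 < l%:R)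
        \sum_(0 <= i < n - l) g l i *: (D i (n - i - l - 1)%N *m X s l)))
    <= \sum_(0 <= l < n) t ^+ (n - l) * antidiag_norm_sum nrm D (n - l) *
      (c (level p q s l) * weighted_norm X s l).
  move=> hg; have W0 : 0 <= t ^+ n * delta `^ (- (s%:R * alpha)).
    by rewrite mulr_ge0 ?powR_ge0// exprn_ge0// ltW.
  rewrite mulrA; apply: le_trans (ler_wpM2l W0 (vnorm_sum hnrm _ _ _)) _.
  rewrite mulr_sumr big_mkcond big_nat [leRHS]big_nat; apply: ler_sum => l /andP[_ ln].
  rewrite valid; case: ifPn => // lev.
  rewrite -[leLHS]mulrA; apply: (@weighted_term_le D (g l)) => // i il; exact: hg.
(* As [i < n - l], [n - i] exceeds [l]; hence the coefficient is evaluated at some [k / q] with [k]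
   at least the level of the source. *)
have exponent s l i : (l < n)%N -> (0 < level p q s l)%N -> (i < n - l)%N ->
    exists2 k, (level p q s l <= k)%N &
      n%:R - i%:R - s%:R * alpha = k%:R / q%:R.
  move=> ln lev il; have li : (l < n - i)%N by lia.
  exists (q * (n - i) - s * p)%N; first exact: level_mono.
  have ile : (i <= n)%N by lia.
  rewrite -natrB// (exponent_level q_gt0 alphaE)//.
  by have := level_mono p q s li; move: lev; rewrite /level; lia.
rewrite {1}/weighted_norm; case: ifPn => [lev|_]; last first.
  rewrite !addr_ge0 ?weighted_norm_ge0//; first by rewrite sumr_ge0.
  case: r => // r; rewrite sumr_ge0// => l _.
  by rewrite -mulrA mulr_ge0 ?powR_ge0.
rewrite hrec ?valid//.
have W0 : 0 <= t ^+ n * delta `^ (- (r%:R * alpha)).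
  by rewrite mulr_ge0 ?powR_ge0// exprn_ge0// ltW.
rewrite mulrA; apply: le_trans (ler_wpM2l W0 (vnormD hnrm _ _)) _.
rewrite mulrDr; apply: lerD.
  apply: le_trans (ler_wpM2l W0 (vnormD hnrm _ _)) _.
  rewrite mulrDr; apply: lerD; first by rewrite /weighted_norm lev mulrA.
  rewrite -[leLHS]mulrA; apply: sum_le => l i ln ll il.
  have [k kl ->] := exponent _ _ _ ln ll il.
  rewrite div1r invf_div ger0_norm ?divr_ge0//.
  by have [] := @c_bound (level p q r l) k (introT andP (conj ll kl)).
case: r lev W0 => [|r] _ _ /=; first by rewrite (vnorm0 hnrm) mulr0.
(* Passing from [r + 1] to [r] costs [delta^(-alpha)], which goes into the second kernel. *)
have -> : delta `^ (- (r.+1%:R * alpha)) = delta `^ (- alpha) * delta `^ (- (r%:R * alpha)).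
  rewrite -powRD; last by rewrite (gt_eqF delta_gt0) implybT.
  by congr (_ `^ _); rewrite -natr1; ring.
rewrite [t ^+ n * _]mulrCA -[leLHS]mulrA -[_ * _ * nrm _]mulrA.
under [leRHS]eq_bigr do rewrite -mulrA.
rewrite -mulr_sumr ler_wpM2l ?powR_ge0//.
rewrite -natr1 addrK; apply: sum_le => l i ln ll il.
have [k kl ->] := exponent _ _ _ ln ll il.
rewrite ger0_norm ?Beta_ge0//.
by have [] := @c_bound (level p q r l) k (introT andP (conj ll kl)).
Qed.

End weighted_recursion.

(** * From bounded weighted sums to the radius of convergence *)

Lemma sum_weighted_norm (R : realType) (N : nat) (nrm : 'cV[R]_N -> R)
    (p q : nat) (alpha delta t : R) (Y : nat -> nat -> 'cV[R]_N) (M : nat) :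
  (0 < p)%N -> (0 < q)%N -> alpha = p%:R / q%:R ->
  \sum_(0 <= n < M) t ^+ n * weighted_norm_sum nrm alpha delta Y n =
  \sum_(0 <= n < M) \sum_(0 <= r < q * M) weighted_norm nrm p q alpha delta t Y r n.
Proof.
move=> p0 q0 alphaE; rewrite big_nat [RHS]big_nat; apply: eq_bigr => n /andP[_ nM].
(* The range [r < q * M] is large enough for all [n < M] at once. *)
have qP : (q * n.+1 <= q * M)%N by rewrite leq_mul2l nM orbT.
rewrite (weighted_norm_sumE q0 alphaE nrm delta Y p0 qP).
rewrite big_mkcond mulr_sumr; apply: eq_bigr => r _.
by rewrite /weighted_norm; case: ifP; rewrite ?mulr0.
Qed.

Lemma weighted_norm_sum_radius (R : realType) (N : nat)
    (nrm : 'cV[R]_N -> R) (p q : nat) (alpha delta : R)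
    (A B : nat -> nat -> 'M[R]_N) (Xi X : nat -> nat -> 'cV[R]_N)
    (rho C0 CL CM t : R) :
  is_vector_norm nrm -> (0 < p)%N -> (p < q)%N -> alpha = p%:R / q%:R ->
  0 < delta -> satisfies_recursion alpha A B Xi X ->
  (forall n : nat, `|weighted_norm_sum nrm alpha delta Xi n| <= C0 / rho ^+ n) ->
  (forall n : nat, `|antidiag_norm_sum nrm A n| <= CL / rho ^+ n) ->
  (forall n : nat, `|antidiag_norm_sum nrm B n| <= CM / rho ^+ n) ->
  0 < t -> t < rho ->
  (t%:E <= convergence_radius (weighted_norm_sum nrm alpha delta X))%E.
Proof.
move=> hnrm p0 pq alphaE delta0 hrec hXi hL hM t0 trho.
have q0 : (0 < q)%N by apply: leq_trans pq.
have s0 : 0 < 1 - alpha.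
  by rewrite subr_gt0 alphaE ltr_pdivrMr ?ltr0n// mul1r ltr_nat.
pose a m := t ^+ m * antidiag_norm_sum nrm A m.
pose b m := delta `^ (- alpha) * (t ^+ m * antidiag_norm_sum nrm B m).
have a0 m : 0 <= a m by rewrite mulr_ge0 ?antidiag_norm_sum_ge0// exprn_ge0// ltW.
have b0 m : 0 <= b m.
  by rewrite !mulr_ge0 ?powR_ge0 ?antidiag_norm_sum_ge0// exprn_ge0// ltW.
have [S [sa sb]] : exists S, (forall m, \sum_(0 <= i < m) a i <= S) /\
    (forall m, \sum_(0 <= i < m) b i <= S).
  exists (CL / (1 - t / rho) + delta `^ (- alpha) * (CM / (1 - t / rho))).
  have aS m : \sum_(0 <= i < m) a i <= CL / (1 - t / rho).
    exact: scaled_sum_le (ltW t0) trho hL.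
  have bS m : \sum_(0 <= i < m) b i <= delta `^ (- alpha) * (CM / (1 - t / rho)).
    rewrite -mulr_sumr ler_wpM2l ?powR_ge0//.
    exact: scaled_sum_le (ltW t0) trho hM.
  have := aS 0%N; have := bS 0%N; rewrite !big_geq// => bS0 aS0.
  by split=> m; [rewrite ler_wpDr|rewrite ler_wpDl].
have S0 : 0 <= S by have := sa 0%N; rewrite big_geq.
have [eta [eta0 hS]] : exists eta, 0 < eta /\ 4 * S * eta <= 1.
  have S1 : 0 < 4 * S + 1 by rewrite ltr_wpDl ?mulr_ge0.
  by exists (4 * S + 1)^-1; rewrite invr_gt0 S1 ler_pdivrMr// mul1r lerDl.
have [c [K [k0 [cK ceta cb]]]] := kernel_coefficient_bound q0 s0 eta0.
have hrecw := weighted_norm_recursion hnrm pq alphaE delta0 t0 hrec cb.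
have w0 Y r n : 0 <= weighted_norm nrm p q alpha delta t Y r n.
  exact: weighted_norm_ge0.
have [D hD] : exists D, forall M P,
    \sum_(0 <= n < M) \sum_(0 <= r < P) weighted_norm nrm p q alpha delta t Xi r n
      <= C0 / (1 - t / rho) ->
    \sum_(0 <= n < M) \sum_(0 <= r < P) weighted_norm nrm p q alpha delta t X r n <= D.
  apply: (@level_sum_bounded _ (level p q) _ _ a b c S _ _ _ a0 b0 _ sa sb _ _
    hrecw K eta k0) => //.
  - by move=> k; have /andP[] := cK k.
  - by move=> r n; rewrite /weighted_norm => ->.
  - by move=> r l n; exact: level_lt.
  - exact: ltW.
  - by move=> k; have /andP[] := cK k.
apply: (@convergence_radius_ge _ _ _ D); last 2 first.
- exact: ltW.
- move=> M; rewrite (sum_weighted_norm _ _ _ _ _ p0 q0 alphaE).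
  apply: hD; rewrite -(sum_weighted_norm _ _ _ _ _ p0 q0 alphaE).
  exact: scaled_sum_le (ltW t0) trho hXi.
move=> n; rewrite (weighted_norm_sumE q0 alphaE _ _ _ p0 (leqnn _)).
by rewrite sumr_ge0// => r _; rewrite mulr_ge0 ?powR_ge0 ?vnorm_ge0.
Qed.

Unset Implicit Arguments.

Theorem theorem4p2 (R : realType) (N : nat)
    (nrm : 'cV[R]_N -> R) (hnrm : is_vector_norm nrm)
    (p q : nat) (hp : (0 < p)%N) (hpq : (p < q)%N) (hcop : coprime p q)
    (alpha : R) (halpha : alpha = p%:R / q%:R)
    (delta : R) (hdelta : 0 < delta)
    (A B : nat -> nat -> 'M[R]_N)
    (Xi X : nat -> nat -> 'cV[R]_N)
    (hrec : satisfies_recursion alpha A B Xi X)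
    (rho C0 CL CM : R) (hrho : 0 < rho)
    (hXi : forall n : nat,
       `|weighted_norm_sum nrm alpha delta Xi n| <= C0 / rho ^+ n)
    (hL : forall n : nat, `|antidiag_norm_sum nrm A n| <= CL / rho ^+ n)
    (hM : forall n : nat, `|antidiag_norm_sum nrm B n| <= CM / rho ^+ n) :
  let Cdelta :=
    q%:R * CL + delta `^ (- alpha) * Beta (1 - alpha) (1 / q%:R) * CM in
  ((rho / (1 + rho * Cdelta))%:E
     <= convergence_radius (weighted_norm_sum nrm alpha delta X))%E.
Proof.
lazy zeta; set Cdelta := q%:R * CL + _.
(* The bounds at [n = 0] make [CL] and [CM] nonnegative; hence [Cdelta >= 0] and the claimed bound
   is at most [rho]. *)
have CL0 : 0 <= CL by have := le_trans (normr_ge0 _) (hL 0%N); rewrite expr0 divr1.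
have CM0 : 0 <= CM by have := le_trans (normr_ge0 _) (hM 0%N); rewrite expr0 divr1.
have Cdelta0 : 0 <= Cdelta.
  apply: addr_ge0; apply: mulr_ge0 => //; apply: mulr_ge0; first exact: powR_ge0.
  exact: Beta_ge0.
apply: (@le_trans _ _ rho%:E).
  have rC0 : 0 <= rho * Cdelta by rewrite mulr_ge0// ltW.
  rewrite lee_fin ler_pdivrMr; last by rewrite ltr_wpDr.
  by rewrite ler_peMr ?(ltW hrho)// lerDl.
have radius t := @weighted_norm_sum_radius _ _ _ _ _ _ _ _ _ _ _ _ _ _ _ t
  hnrm hp hpq halpha hdelta hrec hXi hL hM.
(* The point [rho / 2] excludes the radius [-oo]; the midpoint of [r] and [rho] then refutes a
   finite radius [r < rho]. *)
have [rho2_gt0 rho2_lt] : 0 < rho / 2 /\ rho / 2 < rho by split; lra.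
have := radius _ rho2_gt0 rho2_lt; move: radius.
case: (convergence_radius _) => [r||]//= radius; rewrite ?leey// !lee_fin => r_ge.
rewrite leNgt; apply/negP => r_lt.
have [m_gt0 m_lt] : 0 < (r + rho) / 2 /\ (r + rho) / 2 < rho by split; lra.
by have := radius _ m_gt0 m_lt; rewrite lee_fin; lra.
Qed.
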